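(* Let the score-points $\xi_0\le\xi_1\le\dots\le\xi_{L-1}$ be rational and normalized to $\xi_0=0$, $\xi_{L-1}=1$, and let the home outcome model $\mathsf{P}^{\mathrm h}_y(z)$, $y=0,\dots,L-1$, be not constant in $z$, the away model being fixed by $\mathsf{P}^{\mathrm a}_y(z)=\mathsf{P}^{\mathrm h}_{L-1-y}(-z)$. The point count $s_i=\sum_y\xi_y k_{y;i}$ is a sufficient statistic for the skills (in the sense defined in the context) if and only if (i) the score-points are constant-sum, $\xi_y+\xi_{L-1-y}=1$ for all $y$ (an outcome indexed $y$ by the host being indexed $L-1-y$ by the visitor); and (ii) the outcome probabilities have the form $$\mathsf{P}^{\mathrm h}_y(z)=\frac{e^{\alpha^{\mathrm h}_y+\delta_y z}}{D^{\mathrm h}(z)},\qquad D^{\mathrm h}(z)=\sum_{l=0}^{L-1}e^{\alpha^{\mathrm h}_l+\delta_l z},\qquad y=0,\dots,L-1,$$ with the linear predictor $\alpha^{\mathrm h}_y+\delta_y z$, whose slopes are the score-points, $\delta_y=\xi_y$, and whose intercepts $\alpha^{\mathrm h}_0,\dots,\alpha^{\mathrm h}_{L-1}$ are unconstrained.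
   Context: Players $i=1,\dots,M$ with real skills $\theta_1,\dots,\theta_M$ play one-on-one matches, each having a host and a visitor. The outcome of a match lies in $\{0,1,\dots,L-1\}$ and is ordered from the point of view of one of the two players, the outcome $l$ being more valuable for that player than $l-1$; the outcome indexed $y$ by the host is indexed $L-1-y$ by the visitor. Outcome model. Write $z_{i,j}=\theta_i-\theta_j$. When $i$ hosts $j$, $i$'s outcome is $y$ with probability $\mathsf{P}^{\mathrm h}_y(z_{i,j})$; when $i$ visits $j$, $i$'s outcome is $y$ with probability $\mathsf{P}^{\mathrm a}_y(z_{i,j})$. Since the two perspectives describe the same event, $\mathsf{P}^{\mathrm h}_y(z)=\mathsf{P}^{\mathrm a}_{L-1-y}(-z)$. The model is common to all pairs of players. Write $\ell^{\mathrm h}_y(z)=\log\mathsf{P}^{\mathrm h}_y(z)$. Counts. $k^{\mathrm h}_{y;i,j}$ is the number of matches hosted by $i$ against $j$ that ended in $i$'s outcome $y$; $k^{\mathrm a}_{y;i,j}=k^{\mathrm h}_{L-1-y;j,i}$ is the number of matches in which $i$ visited $j$ and which ended in $i$'s outcome $y$; $k_{y;i}=\sum_j(k^{\mathrm h}_{y;i,j}+k^{\mathrm a}_{y;i,j})$ is the number of times $i$ obtained the outcome $y$ at either venue. The schedule is given by the numbers $k^{\mathrm h}_{i,j}=\sum_y k^{\mathrm h}_{y;i,j}$ of times $i$ hosted $j$. Score. Each outcome $y$ is assigned the score-point $\xi_y$, the same at both venues, and the score (point count) of player $i$ is $s_i=\sum_y\xi_y k_{y;i}$. Sufficiency. The log-likelihood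 is $\mathcal{L}=\sum_{i,j}\sum_y k^{\mathrm h}_{y;i,j}\,\ell^{\mathrm h}_y(\theta_i-\theta_j)$. The score is a sufficient statistic for the skills if the data (the outcome counts) enter the estimating equation of each player $i$, that is, the gradient $\partial\mathcal{L}/\partial\theta_i$, only through that player's score $s_i$, for all skill values and all schedules $k^{\mathrm h}_{i,j}$. Equivalently, for every player $i$, $\mathcal{L}=Q(s_i,\boldsymbol\theta)+R$, where $R$ depends on the counts and on the skills other than $\theta_i$ but does not involve $\theta_i$.
   Formalization: Form (ii) is asserted for P^h_y(cz) with some c≠0, i.e. slopes equal the score-points only up to the unit of skill (P^h_1=σ(2z), L=2, refutes exact slopes), and at least three players are assumed (for M=2, P^h_1=σ(z+z³) is a counterexample). *)

(* Defs.v *)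
From HB Require Import structures.
From mathcomp Require Import all_boot all_order all_algebra.
From mathcomp Require Import all_classical all_reals all_analysis.

Set Implicit Arguments.
Unset Strict Implicit.
Unset Printing Implicit Defensive.

Import Order.TTheory GRing.Theory Num.Theory.
Import numFieldNormedType.Exports.

Local Open Scope ring_scope.

(** Players are [i : 'I_M], outcomes are [y : 'I_L], and [rev_ord y] is the
    outcome [L - 1 - y]. *)

(** [Ph y z] and [Pa y z] are the probabilities that a player gets the outcome
    [y] as host, respectively as visitor, when his skill minus that of the
    opponent is [z].  Positivity and differentiability are what the
    log-likelihood and its gradient need in order to make sense. *)
Record outcome_model (R : realType) (L : nat) (Ph Pa : 'I_L -> R -> R) : Prop :=
  OutcomeModel {
    home_gt0 : forall y z, 0 < Ph y z;
    home_sum1 : forall z, \sum_(y < L) Ph y z = 1;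
    home_derivable : forall y z, derivable (Ph y) z 1;
    away_home : forall y z, Pa y z = Ph (rev_ord y) (- z)
  }.

(** [k i j y] is the number of matches hosted by [i] against [j] that ended
    in the outcome [y] of the host [i]. *)
Definition counts (M L : nat) : Type := 'I_M -> 'I_M -> 'I_L -> nat.

Definition no_self_match (M L : nat) (k : counts M L) : Prop :=
  forall i y, k i i y = 0%N.

Definition away_counts (M L : nat) (k : counts M L) : counts M L :=
  fun i j y => k j i (rev_ord y).

Definition outcome_count (M L : nat) (k : counts M L) (i : 'I_M) (y : 'I_L) :
    nat :=
  (\sum_(j < M) (k i j y + away_counts k i j y))%N.

Definition schedule (M L : nat) (k : counts M L) : 'I_M -> 'I_M -> nat :=
  fun i j => (\sum_(y < L) k i j y)%N.

Definition score (M L : nat) (xi : 'I_L -> rat) (k : counts M L) (i : 'I_M) :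
    rat :=
  \sum_(y < L) xi y * (outcome_count k i y)%:R.

Definition loglik (R : realType) (M L : nat) (Ph : 'I_L -> R -> R)
    (k : counts M L) (theta : 'rV[R]_M) : R :=
  \sum_(i < M) \sum_(j < M) \sum_(y < L)
    (k i j y)%:R * ln (Ph y (theta ord0 i - theta ord0 j)).

(** The partial derivative of the log-likelihood with respect to the skill of
    player [i]: the derivative along the [i]-th basis vector. *)
Definition loglik_grad (R : realType) (M L : nat) (Ph : 'I_L -> R -> R)
    (k : counts M L) (i : 'I_M) (theta : 'rV[R]_M) : R :=
  'D_(delta_mx ord0 i) (loglik Ph k) theta.

(** The schedule is not part of the data: the gradient may depend on it. *)
Definition score_sufficient (R : realType) (M L : nat) (xi : 'I_L -> rat)
    (Ph : 'I_L -> R -> R) : Prop :=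
  forall i : 'I_M,
  exists G : ('I_M -> 'I_M -> nat) -> rat -> 'rV[R]_M -> R,
  forall (k : counts M L) (theta : 'rV[R]_M), no_self_match k ->
    loglik_grad Ph k i theta = G (schedule k) (score xi k i) theta.
Arguments score_sufficient {R} M {L} xi Ph.

Definition constant_sum (L : nat) (xi : 'I_L -> rat) : Prop :=
  forall y, xi y + xi (rev_ord y) = 1.

(** Sufficiency of the score cannot detect the unit in which skills are
    measured: if it holds for [Ph y z], it holds for [Ph y (c * z)].  So the
    slopes [delta] can be identified with given numbers only once that unit is
    fixed, i.e. after replacing [z] by [c * z] for some [c != 0]. *)
Definition linear_predictor_form (R : realType) (L : nat) (delta : 'I_L -> R)
    (Ph : 'I_L -> R -> R) : Prop :=
  exists alpha : 'I_L -> R, forall y z,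
    Ph y z = expR (alpha y + delta y * z) /
             \sum_(l < L) expR (alpha l + delta l * z).

(* Main.v *)
(** Write [g_y] for the derivative of [ln (Ph y)]. The gradient of the log-
    likelihood in the skill of [i] is linear in the counts, with weight [g_y
    (theta_i - theta_j)] for a match hosted by [i] and [- g_y (theta_j -
    theta_i)] for one visited by [i]. Two sets of results with the same
    schedule and the same score of [i] must therefore carry the same weight.
    Write [0] and [1] for the first and last outcomes, and [xi_y = p / (p +
    q)]. Replacing [p + q] outcomes [y] by [p] outcomes [1] and [q] outcomes
    [0] gives [g_y = g_0 + xi_y (g_1 - g_0)]; exchanging a win against [j] and
    a loss against [m] shows that [g_1 - g_0] is a constant [c]; making the
    first replacement in matches visited by [i] gives [xi_y + xi_(L - 1 - y) =
    1]. Integrating [g_y = g_0 + c xi_y] and normalizing the sum of the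
    probabilities yields the exponential form. Conversely [g_y = g_0 + c xi_y]
    and the constant sum make the gradient [c s_i] plus a term depending on
    the schedule only. *)

Require Import Defs.
From HB Require Import structures.
From mathcomp Require Import all_boot all_order all_algebra.
From mathcomp Require Import all_classical all_reals all_analysis.
From mathcomp Require Import ring lra zify.

Set Implicit Arguments.
Unset Strict Implicit.
Unset Printing Implicit Defensive.

Import Order.TTheory GRing.Theory Num.Theory.
Import numFieldNormedType.Exports.

Local Open Scope ring_scope.

(** * The gradient of the log-likelihood as a weighted sum of counts *)

Definition dlog_prob (R : realType) (L : nat) (Ph : 'I_L -> R -> R) (y : 'I_L)
    (z : R) : R :=
  'D_1 (fun t => ln (Ph y t)) z.

Lemma is_derive_ln_prob (R : realType) (L : nat) (Ph Pa : 'I_L -> R -> R) :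
  outcome_model Ph Pa ->
  forall y (z : R), is_derive z 1 (fun t => ln (Ph y t)) (dlog_prob Ph y z).
Proof.
move=> [Ph_gt0 _ dPh _] y z; apply: derivableP.
have d1 : is_derive z 1 (Ph y) ('D_1 (Ph y) z) by exact/derivableP.
have d2 := is_derive1_ln (Ph_gt0 y z).
exact: (@ex_derive _ _ _ _ _ _ _ (is_derive1_comp d2 d1)).
Qed.

Lemma is_derive_bigsum (R : realType) (I : finType) (f : I -> R -> R)
    (df : I -> R) (x : R) :
  (forall i, is_derive x 1 (f i) (df i)) ->
  is_derive x 1 (fun t => \sum_i f i t) (\sum_i df i).
Proof.
move=> dfP.
have -> : (fun t => \sum_i f i t) = \sum_i f i.
  by apply/funext => t; rewrite fct_sumE.
by elim/big_ind2 : _ => // [|] *; [exact: is_derive_cst|exact: is_deriveD].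
Qed.

(** Along the line [h *: v + theta], with [v] the [i]-th basis vector, the skill difference of host
    [a] and visitor [b] has slope [(a == i) - (b == i)]. The chain rule then keeps only the matches
    of [i], with a minus sign when [i] visits. *)
Lemma loglik_gradE (R : realType) (M L : nat) (Ph Pa : 'I_L -> R -> R)
    (k : counts M L) (i : 'I_M) (theta : 'rV[R]_M) :
  outcome_model Ph Pa ->
  loglik_grad Ph k i theta =
  \sum_j \sum_y
    ((k i j y)%:R * dlog_prob Ph y (theta ord0 i - theta ord0 j)
     - (k j i y)%:R * dlog_prob Ph y (theta ord0 j - theta ord0 i)).
Proof.
move=> model.
pose T a b y := (k a b y)%:R * dlog_prob Ph y (theta ord0 a - theta ord0 b).
pose v := delta_mx ord0 i : 'rV[R]_M.
have dline : is_derive (0 : R) 1 (fun h : R => loglik Ph k (h *: v + theta))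
    (\sum_a \sum_b \sum_y T a b y * ((a == i)%:R - (b == i)%:R)).
  apply: is_derive_bigsum => a; apply: is_derive_bigsum => b.
  apply: is_derive_bigsum => y; rewrite /T -mulrA.
  pose line (h : R) := (h *: v + theta) ord0 a - (h *: v + theta) ord0 b.
  have line0 : line 0 = theta ord0 a - theta ord0 b.
    by rewrite /line scale0r add0r.
  have dline : is_derive (0 : R) 1 line ((a == i)%:R - (b == i)%:R).
    have -> : line = (fun h => (theta ord0 a - theta ord0 b) +
                h * ((a == i)%:R - (b == i)%:R)).
      by apply/funext => h; rewrite /line !mxE !eqxx /=; ring.
    have := is_deriveD (is_derive_cst (theta ord0 a - theta ord0 b) (0 : R) 1)
      (is_deriveZ ((a == i)%:R - (b == i)%:R) (is_derive_id (0 : R) 1)).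
    rewrite add0r [_ *: 1]mulr1; congr is_derive.
    by apply/funext => h; congr (_ + _); exact: mulrC.
  have dln := is_derive_ln_prob model y (line 0).
  by have := is_deriveZ (k a b y)%:R (is_derive1_comp dln dline); rewrite line0.
have -> : loglik_grad Ph k i theta =
    'D_1 (fun h : R => loglik Ph k (h *: v + theta)) 0.
  (* Both derivatives are limits of the same difference quotients. *)
  rewrite /loglik_grad /derive; set d1 := fun h => h^-1 *: _.
  set d2 := fun h => h^-1 *: _; suff -> : d1 = d2 by [].
  by apply/funext => h; rewrite /d1 /d2 /= addr0 scale0r add0r [_%:A]mulr1.
rewrite (@derive_val _ _ _ _ _ _ _ dline).
transitivity (\sum_a \sum_b \sum_y (T a b y *+ (a == i) - T a b y *+ (b == i))).
  apply: eq_bigr => a _; apply: eq_bigr => b _; apply: eq_bigr => y _.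
  by rewrite mulrBr !mulr_natr.
transitivity (\sum_b \sum_y T i b y - \sum_a \sum_y T a i y); last first.
  rewrite -sumrB; apply: eq_bigr => j _; rewrite -sumrB.
  exact: eq_bigr.
under eq_bigr do under eq_bigr do rewrite sumrB !sumrMnl.
under eq_bigr do rewrite sumrB.
rewrite sumrB; congr (_ - _).
  rewrite (bigD1 i) //= eqxx [X in _ + X]big1 ?addr0 // => a /negPf ->.
  by rewrite big1.
apply: eq_bigr => a _.
by rewrite (bigD1 i) //= eqxx [X in _ + X]big1 ?addr0 // => b /negPf ->.
Qed.

(** * Counts concentrated on one ordered pair of players *)

Definition matches (M L : nat) (a b : 'I_M) (n : 'I_L -> nat) : counts M L :=
  fun i j y => if (i == a) && (j == b) then n y else 0%N.

Definition add_counts (M L : nat) (k k' : counts M L) : counts M L :=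
  fun i j y => (k i j y + k' i j y)%N.

Lemma no_self_match_matches (M L : nat) (a b : 'I_M) (n : 'I_L -> nat) :
  a != b -> no_self_match (matches a b n).
Proof.
move=> ab i y; rewrite /matches; case: andP => // -[/eqP ia /eqP ib].
by rewrite -ia -ib eqxx in ab.
Qed.

Lemma schedule_matches (M L : nat) (a b : 'I_M) (n n' : 'I_L -> nat) :
  (\sum_y n y = \sum_y n' y)%N ->
  schedule (matches a b n) = schedule (matches a b n').
Proof.
move=> nn'; apply/funext => i; apply/funext => j; rewrite /schedule /matches.
by case: (_ && _).
Qed.

Lemma schedule_add_counts (M L : nat) (k k' : counts M L) :
  schedule (add_counts k k') =
  fun i j => (schedule k i j + schedule k' i j)%N.
Proof. by apply/funext => i; apply/funext => j; exact: big_split. Qed.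

Lemma score_add_counts (M L : nat) (xi : 'I_L -> rat) (k k' : counts M L)
    (i : 'I_M) :
  score xi (add_counts k k') i = score xi k i + score xi k' i.
Proof.
rewrite /score -big_split /=; apply: eq_bigr => y _.
rewrite -mulrDr -natrD; congr (_ * _%:R).
rewrite /outcome_count -big_split /=; apply: eq_bigr => j _.
by rewrite /away_counts /add_counts addnACA.
Qed.

Lemma score_hosted (M L : nat) (xi : 'I_L -> rat) (i j : 'I_M)
    (n : 'I_L -> nat) : i != j ->
  score xi (matches i j n) i = \sum_y (n y)%:R * xi y.
Proof.
move=> ij; apply: eq_bigr => y _; rewrite mulrC; congr (_%:R * _).
rewrite /outcome_count (bigD1 j) //= /away_counts /matches !eqxx /=.
rewrite (negPf ij) andbF addn0 big1 ?addn0 // => m /negPf ->.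
by rewrite andbF.
Qed.

(** The multiplicities [n] are indexed by the outcome of the host [j], so [i] earns the points of
    the reversed outcomes. *)
Lemma score_visited (M L : nat) (xi : 'I_L -> rat) (i j : 'I_M)
    (n : 'I_L -> nat) : i != j ->
  score xi (matches j i n) i = \sum_y (n y)%:R * xi (rev_ord y).
Proof.
move=> ij; rewrite [RHS](reindex_inj rev_ord_inj) /=.
apply: eq_bigr => y _; rewrite mulrC rev_ordK; congr (_%:R * _).
rewrite /outcome_count (bigD1 j) //= /away_counts /matches !eqxx /=.
by rewrite (negPf ij) big1 ?addn0 // => m /negPf ->.
Qed.

Lemma loglik_grad_add_counts (R : realType) (M L : nat)
    (Ph Pa : 'I_L -> R -> R) (k k' : counts M L) (i : 'I_M)
    (theta : 'rV[R]_M) :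
  outcome_model Ph Pa ->
  loglik_grad Ph (add_counts k k') i theta =
  loglik_grad Ph k i theta + loglik_grad Ph k' i theta.
Proof.
move=> model; rewrite !(loglik_gradE _ _ _ model) -big_split /=.
apply: eq_bigr => j _; rewrite -big_split /=; apply: eq_bigr => y _.
by rewrite !natrD; ring.
Qed.

Lemma loglik_grad_hosted (R : realType) (M L : nat) (Ph Pa : 'I_L -> R -> R)
    (i j : 'I_M) (n : 'I_L -> nat) (theta : 'rV[R]_M) :
  outcome_model Ph Pa -> i != j ->
  loglik_grad Ph (matches i j n) i theta =
  \sum_y (n y)%:R * dlog_prob Ph y (theta ord0 i - theta ord0 j).
Proof.
move=> model ij; rewrite (loglik_gradE _ _ _ model) (bigD1 j) //= /matches.
rewrite !eqxx /= (negPf ij) andbF [X in _ + X]big1 => [|m /negPf ->].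
  by rewrite addr0; apply: eq_bigr => y _; rewrite mul0r subr0.
by rewrite andbF big1 // => y _; rewrite !mul0r subr0.
Qed.

Lemma loglik_grad_visited (R : realType) (M L : nat) (Ph Pa : 'I_L -> R -> R)
    (i j : 'I_M) (n : 'I_L -> nat) (theta : 'rV[R]_M) :
  outcome_model Ph Pa -> i != j ->
  loglik_grad Ph (matches j i n) i theta =
  - \sum_y (n y)%:R * dlog_prob Ph y (theta ord0 j - theta ord0 i).
Proof.
move=> model ij; rewrite (loglik_gradE _ _ _ model) (bigD1 j) //= /matches.
rewrite !eqxx /= (negPf ij) [X in _ + X]big1 => [|m /negPf ->].
  by rewrite addr0 -sumrN; apply: eq_bigr => y _; rewrite mul0r sub0r.
by rewrite big1 // => y _; rewrite !mul0r subr0.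
Qed.

(** * Exchanges of results that preserve the schedule and the score *)

Lemma score_sufficient_grad_eq (R : realType) (M L : nat) (xi : 'I_L -> rat)
    (Ph : 'I_L -> R -> R) (k k' : counts M L) (i : 'I_M) (theta : 'rV[R]_M) :
  score_sufficient M xi Ph -> no_self_match k -> no_self_match k' ->
  schedule k = schedule k' -> score xi k i = score xi k' i ->
  loglik_grad Ph k i theta = loglik_grad Ph k' i theta.
Proof.
move=> /(_ i)[G GP] k0 k'0 sched_eq score_eq.
by rewrite !GP// sched_eq score_eq.
Qed.

(** The multiplicities add up when [y = y'], so a single repeated outcome is also of this shape. *)
Definition outcomes2 (L : nat) (p q : nat) (y y' : 'I_L) : 'I_L -> nat :=
  fun l => (p * (l == y) + q * (l == y'))%N.

Lemma sum_outcomes2 (V : pzRingType) (L : nat) (p q : nat) (y y' : 'I_L)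
    (F : 'I_L -> V) :
  \sum_l (outcomes2 p q y y' l)%:R * F l = p%:R * F y + q%:R * F y'.
Proof.
under eq_bigr do rewrite natrD mulrDl.
rewrite big_split /=; congr (_ + _).
  rewrite (bigD1 y) //= eqxx muln1 big1 ?addr0 // => l /negPf ->.
  by rewrite muln0 mul0r.
rewrite (bigD1 y') //= eqxx muln1 big1 ?addr0 // => l /negPf ->.
by rewrite muln0 mul0r.
Qed.

Lemma sumn_outcomes2 (L : nat) (p q : nat) (y y' : 'I_L) :
  (\sum_l outcomes2 p q y y' l = p + q)%N.
Proof.
apply/eqP; rewrite -(eqr_nat rat) natr_sum natrD; apply/eqP.
have := sum_outcomes2 p q y y' (fun=> 1 : rat).
by rewrite !mulr1 => <-; apply: eq_bigr => l _; rewrite mulr1.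
Qed.

(** Rationality of the score-points enters here: [p] wins and [q] losses are worth exactly [p + q]
    outcomes of value [x]. Take [p] the numerator of [x] and [p + q] its denominator. *)
Lemma rat01_frac (x : rat) : 0 <= x -> x <= 1 ->
  exists p q : nat, (0 < p + q)%N /\ (p + q)%:R * x = p%:R.
Proof.
move=> x0 x1.
have d0 : (0 < `|denq x|)%N by rewrite absz_gt0 denq_neq0.
have E : `|denq x|%:R * x = `|numq x|%:R.
  rewrite -[X in _ * X]divq_num_den !natr_absz.
  have n0 : 0 <= numq x by rewrite numq_ge0.
  rewrite (ger0_norm n0) (gtr0_norm (denq_gt0 x)) mulrC divfK //.
  by rewrite intr_eq0 denq_neq0.
have pq : (`|numq x| <= `|denq x|)%N.
  by rewrite -(ler_nat rat) -E ler_piMr.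
by exists `|numq x|%N, (`|denq x| - `|numq x|)%N; rewrite subnKC.
Qed.

(** Among matches hosted by [i] against [j], exchanging [p + q] outcomes [y] for [p] outcomes [hi]
    and [q] outcomes [lo] yields [(p + q) g_y = p g_hi + q g_lo]. *)
Lemma dlog_prob_score (R : realType) (M L : nat) (xi : 'I_L -> rat)
    (Ph Pa : 'I_L -> R -> R) (i j : 'I_M) (lo hi y : 'I_L) (z : R) :
  outcome_model Ph Pa -> score_sufficient M xi Ph -> i != j ->
  xi lo = 0 -> xi hi = 1 -> 0 <= xi y <= 1 ->
  dlog_prob Ph y z =
  dlog_prob Ph lo z + ratr (xi y) * (dlog_prob Ph hi z - dlog_prob Ph lo z).
Proof.
move=> model suff ij xi_lo xi_hi /andP[xi0 xi1].
have [p [q [pq_gt0 pqE]]] := rat01_frac xi0 xi1.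
have pqER : (p + q)%:R * ratr (xi y) = p%:R :> R.
  by rewrite -[p%:R]ratr_nat -pqE rmorphM /= ratr_nat.
(* The skill vector is [z] at [i] and [0] elsewhere, so [i] exceeds [j] by [z]. *)
have := @score_sufficient_grad_eq _ _ _ _ _
  (matches i j (outcomes2 (p + q) 0 y y)) (matches i j (outcomes2 p q hi lo))
  i (z *: delta_mx ord0 i) suff (no_self_match_matches _ ij)
  (no_self_match_matches _ ij).
rewrite !score_hosted// !(loglik_grad_hosted _ _ model ij) !sum_outcomes2.
rewrite xi_lo xi_hi pqE !mul0r mulr0 !addr0 mulr1 !mxE !eqxx /= eq_sym.
rewrite (negPf ij) mulr0 mulr1 subr0 => gradE.
have {}gradE := gradE (schedule_matches _ _ _) erefl.
apply: (@mulfI _ (p + q)%:R); first by rewrite pnatr_eq0 -lt0n.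
rewrite gradE; last by rewrite !sumn_outcomes2 addn0.
by rewrite mulrDr mulrA pqER natrD; ring.
Qed.

(** The third player lets two skill differences occur in one gradient: outcomes [hi] against [j] and
    [lo] against [m] may be swapped, whence [g_hi(z) + g_lo(0) = g_lo(z) + g_hi(0)]. *)
Lemma dlog_prob_range_const (R : realType) (M L : nat) (xi : 'I_L -> rat)
    (Ph Pa : 'I_L -> R -> R) (i j m : 'I_M) (lo hi : 'I_L) (z : R) :
  outcome_model Ph Pa -> score_sufficient M xi Ph ->
  i != j -> i != m -> j != m ->
  dlog_prob Ph hi z - dlog_prob Ph lo z = dlog_prob Ph hi 0 - dlog_prob Ph lo 0.
Proof.
(* Player [i] faces [j] at skill difference [z] and [m] at difference [0]. *)
move=> model suff ij im jm; pose one y := @outcomes2 L 1 0 y y.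
pose trade y y' := add_counts (matches i j (one y)) (matches i m (one y')).
have trade0 y y' : no_self_match (trade y y').
  by move=> a l; rewrite /trade /add_counts !no_self_match_matches.
have := @score_sufficient_grad_eq _ _ _ _ _ (trade hi lo) (trade lo hi)
  i (- z *: delta_mx ord0 j) suff (trade0 _ _) (trade0 _ _).
rewrite !score_add_counts !(loglik_grad_add_counts _ _ _ _ model).
rewrite !score_hosted// !(loglik_grad_hosted _ _ model)// !sum_outcomes2.
rewrite !mul0r !addr0 !mul1r !schedule_add_counts.
rewrite !mxE !eqxx /= (negPf ij) [m == j]eq_sym (negPf jm) !mulr0 mulr1.
rewrite sub0r opprK subr0.
rewrite (@schedule_matches _ _ i j _ (one lo)) ?sumn_outcomes2//.
rewrite (@schedule_matches _ _ i m _ (one hi)) ?sumn_outcomes2//.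
move=> /(_ erefl (addrC _ _)) gradE.
lra.
Qed.

(** Matches hosted by [j] against [i] are exchanged, with [p / (p + q)] the value of the reversed
    outcome, which is the one [i] obtains. Equal gradients give [c (p + q) xi_y = c q], so the
    values of [y] and of its reverse add up to [1]. *)
Lemma score_sufficient_constant_sum (R : realType) (M L : nat)
    (xi : 'I_L -> rat) (Ph Pa : 'I_L -> R -> R) (i j : 'I_M) (lo : 'I_L)
    (c : R) :
  outcome_model Ph Pa -> score_sufficient M xi Ph -> i != j -> c != 0 ->
  xi lo = 0 -> xi (rev_ord lo) = 1 -> (forall y, 0 <= xi y <= 1) ->
  (forall y z, dlog_prob Ph y z = dlog_prob Ph lo z + c * ratr (xi y)) ->
  constant_sum xi.
Proof.
move=> model suff ij c0 xi_lo xi_hi xi01 dlogE y.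
have /andP[xi0 xi1] := xi01 (rev_ord y).
have [p [q [pq_gt0 pqE]]] := rat01_frac xi0 xi1.
have ji : j != i by rewrite eq_sym.
have := @score_sufficient_grad_eq _ _ _ _ _
  (matches j i (outcomes2 (p + q) 0 y y))
  (matches j i (outcomes2 p q lo (rev_ord lo)))
  i 0 suff (no_self_match_matches _ ji) (no_self_match_matches _ ji).
rewrite !score_visited// !(loglik_grad_visited _ _ model ij) !sum_outcomes2.
rewrite pqE rev_ordK xi_lo xi_hi !mul0r mulr0 !addr0 mulr1 !mxE => gradE.
have nn' : (\sum_l outcomes2 (p + q) 0 y y l =
    \sum_l outcomes2 p q lo (rev_ord lo) l)%N.
  by rewrite !sumn_outcomes2 addn0.
have {}gradE := oppr_inj (gradE (schedule_matches _ _ nn') erefl).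
rewrite (dlogE y) (dlogE (rev_ord lo)) xi_hi rmorph1 mulr1 in gradE.
have pqx : (p + q)%:R * ratr (xi y) = q%:R :> R.
  apply: (mulfI c0); rewrite natrD in gradE *; lra.
(* The identity holds in [R]; injectivity of [ratr] brings it back to the rationals. *)
have pqxQ : (p + q)%:R * xi y = q%:R.
  by apply: (fmorph_inj (@ratr R)); rewrite rmorphM /= !ratr_nat.
apply: (@mulfI _ (p + q)%:R); first by rewrite pnatr_eq0 -lt0n.
by rewrite mulrDr pqE pqxQ mulr1 natrD addrC.
Qed.

(** * Integration of the log-derivatives, and the converse implication *)

(** Both sides say that [ln (Ph y z) - ln (Ph lo z) - b * z] is constant in [z]: one by its zero
    derivative, the other by its value [a]. *)
Lemma dlog_prob_affine (R : realType) (L : nat) (Ph Pa : 'I_L -> R -> R)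
    (lo y : 'I_L) (b : R) :
  outcome_model Ph Pa ->
  (forall z, dlog_prob Ph y z = dlog_prob Ph lo z + b) <->
  exists a, forall z, Ph y z = Ph lo z * expR (a + b * z).
Proof.
move=> model; have Ph_gt0 := home_gt0 model.
have dP (l : 'I_L) (z : R) := is_derive_ln_prob model l z.
pose f z := ln (Ph y z) - ln (Ph lo z) - b * z.
have df (z : R) : is_derive z 1 f (dlog_prob Ph y z - dlog_prob Ph lo z - b).
  have := is_deriveB (is_deriveB (dP y z) (dP lo z))
    (is_deriveZ b (is_derive_id z (1 : R))).
  by rewrite [b *: 1]mulr1.
split=> [dE|[a PhE] z].
  exists (f 0) => z; apply: ln_inj; rewrite ?posrE ?mulr_gt0 ?expR_gt0//.
  rewrite lnM ?posrE ?expR_gt0// expRK.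
  have <- : f z = f 0.
    apply: is_derive_0_is_cst => t; have := df t.
    by rewrite dE addrAC addrK subrr.
  by rewrite /f; ring.
have fE : f = cst a.
  apply/funext => t; rewrite /f PhE lnM ?posrE ?expR_gt0// expRK /=; ring.
have d0 := @derive_val _ _ _ _ _ _ _ (df z).
have : 'D_1 f z = 0 by rewrite fE derive_val.
by rewrite d0 => /eqP; rewrite subr_eq0 subr_eq addrC => /eqP.
Qed.

Lemma score_sufficient_of_dlog (R : realType) (M L : nat) (xi : 'I_L -> rat)
    (Ph Pa : 'I_L -> R -> R) (lo : 'I_L) (b : R) :
  outcome_model Ph Pa -> constant_sum xi ->
  (forall y z, dlog_prob Ph y z = dlog_prob Ph lo z + b * ratr (xi y)) ->
  score_sufficient M xi Ph.
Proof.
move=> model csum dlogE i.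
(* A visited match with host outcome [y] weighs [- (g_lo + b xi_y)], which the constant sum turns
   into [b xi_(L - 1 - y) - (g_lo + b)]: a score term, and a term that no longer depends on [y]. *)
exists (fun s x theta => b * ratr x + \sum_j
  ((s i j)%:R * dlog_prob Ph lo (theta ord0 i - theta ord0 j)
   - (s j i)%:R * (dlog_prob Ph lo (theta ord0 j - theta ord0 i) + b))).
move=> k theta _; rewrite (loglik_gradE _ _ _ model).
have -> : ratr (score xi k i) = \sum_j \sum_y
    (ratr (xi y) * (k i j y)%:R + (1 - ratr (xi y)) * (k j i y)%:R) :> R.
  rewrite /score rmorph_sum /=.
  under eq_bigr do rewrite rmorphM /= ratr_nat natr_sum mulr_sumr.
  rewrite exchange_big /=; apply: eq_bigr => j _.
  under eq_bigr do rewrite natrD mulrDr.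
  rewrite !big_split /=; congr (_ + _).
  rewrite (reindex_inj rev_ord_inj) /=; apply: eq_bigr => y _.
  rewrite /away_counts rev_ordK; congr (_ * _).
  by rewrite -(rmorph1 (@ratr R)) -(csum y) rmorphD /= [_ + ratr _]addrC addrK.
rewrite mulr_sumr -big_split /=; apply: eq_bigr => j _.
rewrite !natr_sum mulr_sumr !mulr_suml -sumrB -big_split /=.
by apply: eq_bigr => y _; rewrite !(dlogE y); ring.
Qed.

(** Ratios to [Ph lo] cancel the common denominator and are pure exponentials; conversely, summing
    the probabilities to [1] forces [Ph lo] to be the inverse of the denominator. Replacing [z] by
    [c * z] multiplies slopes by [c], hence the factor [c^-1]. *)
Lemma linear_predictor_formP (R : realType) (L : nat) (delta : 'I_L -> R)
    (Ph Pa : 'I_L -> R -> R) (lo : 'I_L) (c : R) :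
  outcome_model Ph Pa -> delta lo = 0 -> c != 0 ->
  linear_predictor_form delta (fun y z => Ph y (c * z)) <->
  forall y z, dlog_prob Ph y z = dlog_prob Ph lo z + c^-1 * delta y.
Proof.
move=> model delta_lo c0; split=> [[alpha PhE] y|dlogE].
  apply/(dlog_prob_affine _ _ _ model); exists (alpha y - alpha lo) => z.
  have -> : z = c * (c^-1 * z) by rewrite mulVKf.
  rewrite !PhE mulrAC -expRD delta_lo; congr (expR _ / _).
  by field.
have /choice[a PhE] y : exists a, forall z,
    Ph y z = Ph lo z * expR (a + c^-1 * delta y * z).
  by apply/(dlog_prob_affine _ _ _ model).
exists a => y z; rewrite PhE.
have arg l : a l + c^-1 * delta l * (c * z) = a l + delta l * z by field.
have sum1 : Ph lo (c * z) * (\sum_l expR (a l + delta l * z)) = 1.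
  rewrite -(home_sum1 model (c * z)) mulr_sumr.
  by apply: eq_bigr => l _; rewrite [RHS]PhE arg.
have sum0 : \sum_l expR (a l + delta l * z) != 0.
  by apply: contra_eqN sum1 => /eqP ->; rewrite mulr0 eq_sym oner_eq0.
rewrite arg mulrC; congr (_ * _).
by apply: (mulIf sum0); rewrite sum1 mulVf.
Qed.

(** With all slopes zero the exponential form does not involve [z]. A nonconstant model therefore
    excludes a zero range [g_hi - g_lo]. *)
Lemma dlog_prob_eq_const (R : realType) (L : nat) (Ph Pa : 'I_L -> R -> R)
    (lo : 'I_L) :
  outcome_model Ph Pa ->
  (forall y z, dlog_prob Ph y z = dlog_prob Ph lo z) ->
  forall y z z', Ph y z = Ph y z'.
Proof.
move=> model dlogE.
have [|alpha PhE] := (linear_predictor_formP (delta := fun=> 0) (c := 1) model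
  (erefl : (fun=> 0) lo = 0) (oner_neq0 R)).2.
  by move=> y z; rewrite dlogE mulr0 addr0.
by move=> y z z'; rewrite -[z]mul1r -[z']mul1r !PhE !mul0r.
Qed.

Theorem lemma1 (R : realType) (M L : nat) (xi : 'I_L -> rat)
    (Ph Pa : 'I_L -> R -> R)
    (M_gt2 : (2 < M)%N) (L_gt1 : (1 < L)%N)
    (xi_homo : forall y y' : 'I_L, (y <= y')%N -> xi y <= xi y')
    (xi_first : forall y : 'I_L, y = 0%N :> nat -> xi y = 0)
    (xi_last : forall y : 'I_L, y = L.-1 :> nat -> xi y = 1)
    (model : outcome_model Ph Pa)
    (nonconstant : exists y z z', Ph y z <> Ph y z') :
  score_sufficient M xi Ph <->
  constant_sum xi /\
  exists2 c : R, c != 0 &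
    linear_predictor_form (fun y => ratr (xi y)) (fun y z => Ph y (c * z)).
Proof.
have L_gt0 : (0 < L)%N := ltnW L_gt1.
pose lo : 'I_L := Ordinal L_gt0.
have xi_lo : xi lo = 0 by exact: xi_first.
have xi_hi : xi (rev_ord lo) = 1 by apply: xi_last; rewrite /= subn1.
have xi01 y : 0 <= xi y <= 1.
  rewrite -xi_lo xi_homo //= -xi_hi xi_homo //= subn1.
  by have := ltn_ord y; lia.
have ratr_lo : ratr (xi lo) = 0 :> R by rewrite xi_lo rmorph0.
split=> [suff|[csum [c c0]]]; last first.
  move/(linear_predictor_formP model ratr_lo c0) => dlogE.
  exact: score_sufficient_of_dlog model csum dlogE.
pose i : 'I_M := Ordinal (ltnW (ltnW M_gt2)).
pose j : 'I_M := Ordinal (ltnW M_gt2).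
pose m : 'I_M := Ordinal M_gt2.
have ij : i != j by [].
pose c := dlog_prob Ph (rev_ord lo) 0 - dlog_prob Ph lo 0.
have dlogE y z : dlog_prob Ph y z = dlog_prob Ph lo z + c * ratr (xi y).
  rewrite (dlog_prob_score _ model suff ij xi_lo xi_hi (xi01 y)) mulrC.
  by rewrite (@dlog_prob_range_const _ _ _ _ _ _ i j m _ _ z model suff).
have c0 : c != 0.
  apply/eqP => c0; have [y [z [z' []]]] := nonconstant.
  apply: (dlog_prob_eq_const model) => {}y {}z.
  by rewrite dlogE c0 mul0r addr0.
split.
  exact: score_sufficient_constant_sum model suff ij c0 xi_lo xi_hi xi01 dlogE.
(* The slopes of [Ph] in [z] are [c] times the score-points, so the skill unit must be rescaled by
   [c^-1]. *)
exists c^-1; first by rewrite invr_eq0.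
apply/(linear_predictor_formP model ratr_lo); first by rewrite invr_eq0.
by move=> y z; rewrite invrK.
Qed.
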